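(* Let $\mathbb{M}_2$ be the algebra of $2 \times 2$ complex matrices with identity matrix $I_2$, and let $A, B \in \mathbb{M}_2$ with $0 \le A \le I_2$ and $0 \le B \le I_2$. Then $A$ and $B$ are strict and absolutely compatible in $\mathbb{M}_2^+$ if and only if there exist rank one projections $P$ and $Q$ in $\mathbb{M}_2$ with $P \notin \{Q, Q'\}$, where $Q' = I_2 - Q$, and a real number $\lambda$ with $0 < \lambda < 1$ such that $A = (1 - \lambda) P + \lambda Q$ and $B = (1 - \lambda) P + \lambda Q'$.
   Context: ''Projection'' means orthogonal (self-adjoint idempotent) projection. An element $X \in \mathbb{M}_2$ with $0 \le X \le I_2$ is strict if $s(X) = 0$ and $n(X) = 0$, where $s(X)$ is the supremum of all projections $q \in \mathbb{M}_2$ with $q \le X$ and $n(X)$ is the supremum of all projections $q \in \mathbb{M}_2$ with $qX = 0$. Elements $0 \le A, B \le I_2$ are absolutely compatible if $|A - B| + |I_2 - A - B| = I_2$, where $|X| = (X^*X)^{1/2}$. *)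

(* Defs.v *)
From mathcomp Require Import all_boot all_order all_algebra.
From mathcomp Require Import complex.
From mathcomp Require Import boolp classical_sets reals.

Set Implicit Arguments.
Unset Strict Implicit.
Unset Printing Implicit Defensive.

Import Order.TTheory GRing.Theory Num.Theory.

Local Open Scope ring_scope.
Local Open Scope classical_set_scope.
Local Open Scope sesquilinear_scope.

(* On C the relation 0 <= z means that z is real and nonnegative. *)
Definition posmx (C : numClosedFieldType) (n : nat) (X : 'M[C]_n) : Prop :=
  X ^t* = X /\ forall v : 'cV[C]_n, 0 <= (v ^t* *m X *m v) 0 0.

Definition lemx (C : numClosedFieldType) (n : nat) (X Y : 'M[C]_n) : Prop :=
  posmx (Y - X).

Definition projection (C : numClosedFieldType) (n : nat) (P : 'M[C]_n) : Prop :=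
  P ^t* = P /\ P *m P = P.

(* The positive square root of a positive matrix exists and is unique, so the
   default value 0 is never taken when Y is positive. *)
Definition sqrtmx (C : numClosedFieldType) (n : nat) (Y : 'M[C]_n) : 'M[C]_n :=
  xget 0 [set Z | posmx Z /\ Z *m Z = Y].

Definition absmx (C : numClosedFieldType) (n : nat) (X : 'M[C]_n) : 'M[C]_n :=
  sqrtmx (X ^t* *m X).

(* The supremum is taken in the lattice of projections: the least projection
   above all elements of S. *)
Definition is_sup_proj (C : numClosedFieldType) (n : nat)
    (S : set 'M[C]_n) (p : 'M[C]_n) : Prop :=
  [/\ projection p,
      forall q, S q -> lemx q p
    & forall r, projection r -> (forall q, S q -> lemx q r) -> lemx p r].

(* The projection lattice of a matrix algebra is complete, so the default value
   is never taken on a set S of projections; it is nonzero in order that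
   sup_proj S = 0 could not hold by default. *)
Definition sup_proj (C : numClosedFieldType) (n : nat)
    (S : set 'M[C]_n) : 'M[C]_n :=
  xget 1%:M (is_sup_proj S).

Definition s_proj (C : numClosedFieldType) (n : nat) (X : 'M[C]_n) : 'M[C]_n :=
  sup_proj [set q | projection q /\ lemx q X].

Definition n_proj (C : numClosedFieldType) (n : nat) (X : 'M[C]_n) : 'M[C]_n :=
  sup_proj [set q | projection q /\ q *m X = 0].

Definition strict (C : numClosedFieldType) (n : nat) (X : 'M[C]_n) : Prop :=
  s_proj X = 0 /\ n_proj X = 0.

Definition absolutely_compatible (C : numClosedFieldType) (n : nat)
    (A B : 'M[C]_n) : Prop :=
  absmx (A - B) + absmx (1%:M - A - B) = 1%:M.

(* Main.v *)
Require Import Defs.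
From mathcomp Require Import all_boot all_order all_algebra.
From mathcomp Require Import complex ring.
From mathcomp Require Import boolp classical_sets reals.

Set Implicit Arguments.
Unset Strict Implicit.
Unset Printing Implicit Defensive.

Import Order.TTheory GRing.Theory Num.Theory.

Local Open Scope ring_scope.
Local Open Scope complex_scope.
Local Open Scope sesquilinear_scope.

(** Put S = A - B and T = 1 - A - B, so that A = (1 + S - T) / 2 and
    B = (1 - S - T) / 2.  Absolute compatibility says |S| + |T| = 1.

    The first point is that strictness excludes any commutation.  If S, T and
    X = |S| were all polynomials in one matrix, then S^2 = X^2 and
    T^2 = (1 - X)^2 would give
      (1 + S - T) (1 - S + T) (1 - S - T) (1 + S + T)
        = (1 - S^2 - T^2)^2 - 4 S^2 T^2
        = (2 X (1 - X))^2 - 4 X^2 (1 - X)^2 = 0,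
    where the left side is 16 A (1 - A) B (1 - B).  But a strict A has both A
    and 1 - A invertible, since the orthogonal projection onto a line in the
    kernel of A (resp. 1 - A) lies below n(A) (resp. s(A)).  This is
    [compat_poly_det] combined with [strict_det].

    The second point is special to size 2.  By Cayley-Hamilton, X^2 = S^2 makes
    tr(X) X and tr(S) S differ by a scalar, so that X is scalar unless S is an
    affine function of X; the same holds for 1 - X and T.  By the first point S
    and T cannot both be affine in X, hence X = x is scalar.  Then S / x and
    T / (1 - x) are self-adjoint with square 1, that is, reflections: writing
    S = x (2 Q - 1) and T = (1 - x) (1 - 2 P) gives the required formulas with
    lambda = x.  The projections P and Q have rank one, and P is neither Q nor
    1 - Q, because otherwise S and T would be affine in a common matrix.

    Conversely, the two formulas give A - B = lambda (2 Q - 1) and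
    1 - A - B = (1 - lambda) (1 - 2 P), multiples of reflections, whose absolute
    values are the scalars lambda and 1 - lambda.  For strictness, a nonzero
    projection q with q A = 0 kills both P and Q by positivity, which in size 2
    forces P = 1 - q = Q; the case q <= A is the same with 1 - A, 1 - P and
    1 - Q in place of A, P and Q. *)

(** * Adjoints and positive matrices *)

Section Adjoint.
Variable C : numClosedFieldType.

Lemma adjmxM m n p (A : 'M[C]_(m, n)) (B : 'M[C]_(n, p)) :
  (A *m B) ^t* = B ^t* *m A ^t*.
Proof. by rewrite trmx_mul map_mxM. Qed.

Lemma adjmxD m n (A B : 'M[C]_(m, n)) : (A + B) ^t* = A ^t* + B ^t*.
Proof. by rewrite linearD map_mxD. Qed.

Lemma adjmxB m n (A B : 'M[C]_(m, n)) : (A - B) ^t* = A ^t* - B ^t*.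
Proof. by rewrite linearB map_mxB. Qed.

Lemma adjmxZ_real m n (a : C) (A : 'M[C]_(m, n)) :
  a \is Num.real -> (a *: A) ^t* = a *: A ^t*.
Proof. by move=> /CrealP aR; rewrite linearZ map_mxZ /= aR. Qed.

Lemma adjmx1 n : (1%:M : 'M[C]_n) ^t* = 1%:M.
Proof. by rewrite trmx1 map_mx1. Qed.

Lemma adjmx0 m n : (0 : 'M[C]_(m, n)) ^t* = 0.
Proof. by rewrite trmx0 map_mx0. Qed.

Lemma mxtrace_adjM m n (M : 'M[C]_(m, n)) :
  \tr (M ^t* *m M) = \sum_j \sum_i `|M i j| ^+ 2.
Proof.
apply: eq_bigr => j _; rewrite mxE; apply: eq_bigr => i _.
by rewrite !mxE normCKC.
Qed.

(** The Hilbert-Schmidt norm is definite; every vanishing result about positive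
    matrices below comes from this one. *)
Lemma mxtrace_adjM_eq0 m n (M : 'M[C]_(m, n)) : \tr (M ^t* *m M) = 0 -> M = 0.
Proof.
rewrite mxtrace_adjM => tr0; apply/matrixP => i j; rewrite mxE.
have col_ge0 k : true -> 0 <= \sum_i `|M i k| ^+ 2.
  by move=> _; apply: sumr_ge0 => l _; rewrite exprn_ge0.
have /(_ j isT) := psumr_eq0P col_ge0 tr0.
have ent_ge0 k : true -> 0 <= `|M k j| ^+ 2 by rewrite exprn_ge0.
by move=> /(psumr_eq0P ent_ge0)/(_ i isT)/eqP; rewrite expf_eq0 normr_eq0 => /eqP.
Qed.

Lemma adjM_eq0 m n (M : 'M[C]_(m, n)) : M ^t* *m M = 0 -> M = 0.
Proof. by move=> M0; apply: mxtrace_adjM_eq0; rewrite M0 mxtrace0. Qed.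

End Adjoint.

Section Positive.
Variables (C : numClosedFieldType) (n : nat).
Implicit Types (X Y Z q P Q : 'M[C]_n).

Lemma posmxD X Y : posmx X -> posmx Y -> posmx (X + Y).
Proof.
move=> [hX pX] [hY pY]; split; first by rewrite adjmxD hX hY.
by move=> v; rewrite mulmxDr mulmxDl mxE addr_ge0.
Qed.

Lemma posmxZ (a : C) X : 0 <= a -> posmx X -> posmx (a *: X).
Proof.
move=> a0 [hX pX]; split; first by rewrite adjmxZ_real ?ger0_real // hX.
by move=> v; rewrite -scalemxAr -scalemxAl mxE mulr_ge0.
Qed.

Lemma posmx_adjM m (M : 'M[C]_(m, n)) : posmx (M ^t* *m M).
Proof.
split; first by rewrite adjmxM trmxCK.
move=> v; rewrite !mulmxA -mulmxA -adjmxM mxE.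
by apply: sumr_ge0 => i _; rewrite !mxE -normCKC exprn_ge0.
Qed.

Lemma posmx_conj X Y : posmx X -> posmx (Y ^t* *m X *m Y).
Proof.
move=> [hX pX]; split; first by rewrite !adjmxM trmxCK hX mulmxA.
by move=> v; have := pX (Y *m v); rewrite adjmxM !mulmxA.
Qed.

Lemma posmx_diag_ge0 X i : posmx X -> 0 <= X i i.
Proof.
move=> [_ /(_ (delta_mx i 0))].
rewrite trmx_delta map_delta_mx -rowE -colE.
by rewrite !mxE.
Qed.

Lemma posmx_trace_ge0 X : posmx X -> 0 <= \tr X.
Proof. by move=> pX; apply: sumr_ge0 => i _; apply: posmx_diag_ge0. Qed.

Lemma posmx_diag_mx (d : 'rV[C]_n) : (forall i, 0 <= d 0 i) -> posmx (diag_mx d).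
Proof.
move=> d_ge0; pose r := \row_j sqrtC (d 0 j).
have -> : diag_mx d = diag_mx r ^t* *m diag_mx r.
  rewrite tr_diag_mx map_diag_mx mulmx_diag; congr diag_mx.
  by apply/rowP => j; rewrite !mxE -normCKC ger0_norm ?sqrtC_ge0 ?sqrtCK.
exact: posmx_adjM.
Qed.

(** The square root is taken on the eigenvalues given by the spectral theorem. *)
Lemma posmx_sqrt Y : posmx Y -> exists Z, posmx Z /\ Z *m Z = Y.
Proof.
move=> pY; have [hY _] := pY.
have /orthomx_spectralP : Y \is normalmx by apply/normalmxP; rewrite hY.
set U := spectralmx Y; set d := spectral_diag Y.
have Uu : U \is unitarymx := spectral_unitarymx Y.
rewrite invmx_unitary // => eqY.
have UU : U *m U ^t* = 1%:M by apply/unitarymxP.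
have d_ge0 i : 0 <= d 0 i.
  have : posmx (U ^t* ^t* *m Y *m U ^t*) by apply: posmx_conj.
  rewrite trmxCK {1}eqY !mulmxA UU mul1mx -mulmxA UU mulmx1.
  by move=> /(posmx_diag_ge0 i); rewrite mxE eqxx.
pose e := \row_j sqrtC (d 0 j).
have ee : diag_mx e *m diag_mx e = diag_mx d.
  by rewrite mulmx_diag; congr diag_mx; apply/rowP => j; rewrite !mxE -expr2 sqrtCK.
exists (U ^t* *m diag_mx e *m U); split.
  by apply/posmx_conj/posmx_diag_mx => j; rewrite mxE sqrtC_ge0.
by rewrite [RHS]eqY -ee !mulmxA -[_ *m U *m U ^t*]mulmxA UU mulmx1.
Qed.

(** Existence of a square root is what rules out the default value in
    the choice that defines [absmx]. *)
Lemma absmxP X : posmx (absmx X) /\ absmx X *m absmx X = X ^t* *m X.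
Proof.
rewrite /absmx /sqrtmx; case: xgetP => [Z _ //|].
have [Z ZP] := posmx_sqrt (posmx_adjM X).
by move=> /(_ Z) [].
Qed.

Lemma posmx_trace_eq0 X : posmx X -> \tr X = 0 -> X = 0.
Proof.
move=> /posmx_sqrt [Z [[hZ _] <-]]; rewrite -{1}hZ => /mxtrace_adjM_eq0 ->.
by rewrite mul0mx.
Qed.

Lemma posmx_addr_eq0 X Y : posmx X -> posmx Y -> X + Y = 0 -> X = 0.
Proof.
move=> pX pY XY0; apply: posmx_trace_eq0 => //.
have /eqP : \tr X + \tr Y = 0 by rewrite -mxtraceD XY0 mxtrace0.
by rewrite paddr_eq0 ?posmx_trace_ge0 // => /andP[/eqP].
Qed.

Lemma projection_posmx P : projection P -> posmx P.
Proof. by move=> [hP PP]; rewrite -PP -{1}hP; apply: posmx_adjM. Qed.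

Lemma projectionC P : projection P -> projection (1%:M - P).
Proof.
move=> [hP PP]; split; first by rewrite adjmxB adjmx1 hP.
by rewrite mulmxBr mulmx1 mulmxBl mul1mx PP subrr subr0.
Qed.

Lemma projection0 : projection (0 : 'M[C]_n).
Proof. by split; rewrite ?adjmx0 ?mul0mx. Qed.

(** This is uniqueness of the positive square root Z of x^2: the self-adjoint
    matrix D = Z - x satisfies D (x + Z) D = (Z^2 - x^2) D = 0, a sum of the
    positive matrices x D^2 and D Z D, hence x D^2 = 0. *)
Lemma absmx_scaled_reflection (x : C) (J : 'M[C]_n) :
  0 < x -> J ^t* = J -> J *m J = 1%:M -> absmx (x *: J) = x%:M.
Proof.
move=> x_gt0 hJ JJ; have [[hZ pZ]] := absmxP (x *: J).
set Z := absmx _; have xR := gtr0_real x_gt0.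
rewrite adjmxZ_real // hJ -scalemxAl -scalemxAr JJ scalerA => ZZ.
have hD : (Z - x%:M) ^t* = Z - x%:M.
  by rewrite adjmxB hZ -scalemx1 adjmxZ_real // adjmx1.
apply/eqP; rewrite -subr_eq0; apply/eqP.
apply: adjM_eq0; apply: (scalerI (lt0r_neq0 x_gt0)); rewrite scaler0.
have pD : posmx (x *: ((Z - x%:M) ^t* *m (Z - x%:M))).
  by apply: posmxZ (ltW x_gt0) _; apply: posmx_adjM.
apply: posmx_addr_eq0 pD (posmx_conj (Z - x%:M) (conj hZ pZ)) _.
rewrite hD -mul_scalar_mx mulmxA -mulmxDl -scalar_mxC -mulmxDr.
suff -> : (Z - x%:M) *m (x%:M + Z) = 0 by rewrite mul0mx.
by rewrite mulmxDr !mulmxBl ZZ scalemx1 -scalar_mxM -scalar_mxC addrA subrK subrr.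
Qed.
End Positive.

(** * Strict elements *)

Section Strict.
Variable C : numClosedFieldType.

(** In positive size the default value 1 of [sup_proj] differs from 0, so
    sup_proj S = 0 does mean that 0 is the supremum of S. *)
Lemma sup_proj_eq0 n (S : set 'M[C]_n) : (0 < n)%N ->
  (forall q, S q -> projection q) ->
  sup_proj S = 0 <-> (forall q, S q -> q = 0).
Proof.
case: n S => // n S _ Sproj; split.
  rewrite /sup_proj; case: xgetP => [p -> [pp ub _] p0 q Sq|_ /eqP]; last first.
    by rewrite oner_eq0.
  have := ub q Sq; rewrite p0 /lemx sub0r => pNq.
  by apply: posmx_addr_eq0 (projection_posmx (Sproj q Sq)) pNq _; rewrite subrr.
move=> S0; have sup0 : is_sup_proj S 0.
  split; first exact: projection0.
    by move=> q /S0 ->; rewrite /lemx subr0; apply/projection_posmx/projection0.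
  by move=> r rp _; rewrite /lemx subr0; apply: projection_posmx.
rewrite /sup_proj; case: xgetP => [p _ [pp _ lub]|/(_ 0)//].
have := lub 0 (projection0 _ _) (let: And3 _ ub _ := sup0 in ub).
rewrite /lemx sub0r => pNp.
by apply: posmx_addr_eq0 (projection_posmx pp) pNp _; rewrite subrr.
Qed.

Lemma strictP n (X : 'M[C]_n) : (0 < n)%N ->
  strict X <-> (forall q, projection q -> lemx q X -> q = 0) /\
               (forall q, projection q -> q *m X = 0 -> q = 0).
Proof.
move=> n_gt0; rewrite /strict /s_proj /n_proj !sup_proj_eq0 //; try by move=> q [].
split=> -[s0 n0]; split=> q; first by move=> *; apply: s0.
- by move=> *; apply: n0.
- by case; apply: s0.
- by case; apply: n0.
Qed.

(** For a row u in the left kernel with adjoint v, the witness is v u divided by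
    the number c = u v, the orthogonal projection onto the line spanned by v. *)
Lemma left_kernel_projection n (X : 'M[C]_n) : \det X = 0 ->
  exists q, [/\ projection q, q != 0 & q *m X = 0].
Proof.
move=> /eqP/det0P [u u_neq0 uX].
pose c := (u *m u ^t*) 0 0.
have uu : u *m u ^t* = c%:M by rewrite [LHS]mx11_scalar.
have c_eq : c = \sum_i `|u 0 i| ^+ 2.
  by rewrite /c mxE; apply: eq_bigr => i _; rewrite !mxE normCK.
have c_real : c \is Num.real.
  by rewrite c_eq ger0_real // sumr_ge0 // => i _; rewrite exprn_ge0.
have c_neq0 : c != 0.
  apply: contraNneq u_neq0 => c0.
  have /adjM_eq0 /(congr1 (fun M => M ^t*)) : (u ^t*) ^t* *m u ^t* = 0.
    by rewrite trmxCK uu c0 -scalemx1 scale0r.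
  by rewrite trmxCK adjmx0 => ->.
exists (c^-1 *: (u ^t* *m u)); split; first split.
- by rewrite adjmxZ_real ?realV // adjmxM trmxCK.
- rewrite -scalemxAl -scalemxAr mulmxA -[_ *m u *m _]mulmxA uu.
  by rewrite mul_mx_scalar -scalemxAl scalerK.
- apply: contraNneq u_neq0 => /(congr1 (mulmx u)).
  rewrite mulmx0 -scalemxAr mulmxA uu mul_scalar_mx scalerA mulVf // scale1r.
  by move=> ->.
- by rewrite -scalemxAl -mulmxA uX mulmx0 scaler0.
Qed.

(** A projection q with q (1 - X) = 0 commutes with X, and
    X - q = (1 - q) X (1 - q) is positive, so q <= X. *)
Lemma strict_det n (X : 'M[C]_n) : (0 < n)%N -> lemx 0 X -> strict X ->
  \det X != 0 /\ \det (1%:M - X) != 0.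
Proof.
move=> n_gt0; rewrite /lemx subr0 => pX /(strictP X n_gt0) [s0 n0].
split; apply/eqP => /left_kernel_projection [q [qp q_neq0 qX]].
  by move/eqP: q_neq0; apply; apply: n0.
move/eqP: q_neq0; apply; apply: s0 => //; rewrite /lemx.
move: qX; rewrite mulmxBr mulmx1 => /eqP; rewrite subr_eq0 => /eqP qX.
have [hq qq] := qp; have [hX _] := pX.
have Xq : X *m q = q by rewrite -{1}hX -{1}hq -adjmxM -qX.
suff -> : X - q = (1%:M - q) ^t* *m X *m (1%:M - q) by apply: posmx_conj.
rewrite adjmxB adjmx1 hq mulmxBl mul1mx -qX mulmxBr mulmx1 mulmxBl Xq qq.
by rewrite subrr subr0.
Qed.

(** Both compressions q P q and q Q q are positive, so each vanishes when their
    positive combination does, and then P q = 0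
    because q P q is the product of the adjoint of P q with P q. *)
Lemma projection_pos_comb_eq0 n (a b : C) (q P Q : 'M[C]_n) :
  0 < a -> 0 < b -> projection q -> projection P -> projection Q ->
  q *m (a *: P + b *: Q) *m q = 0 -> q *m P = 0 /\ q *m Q = 0.
Proof.
move=> + + [hq qq].
wlog suff main : a b P Q / 0 < a -> 0 < b -> projection P -> projection Q ->
    q *m (a *: P + b *: Q) *m q = 0 -> q *m P = 0.
  move=> a0 b0 pP pQ e0; split; first exact: main e0.
  by move: e0; rewrite addrC; apply: main.
move=> a0 b0 pP pQ; rewrite mulmxDr mulmxDl -!scalemxAr -!scalemxAl.
have compr_ge0 c E : 0 < c -> projection E -> posmx (c *: (q *m E *m q)).
  move=> c0 /projection_posmx pE; apply: posmxZ (ltW c0) _.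
  by rewrite -{1}hq; apply: posmx_conj.
move=> /(posmx_addr_eq0 (compr_ge0 _ _ a0 pP) (compr_ge0 _ _ b0 pQ))/eqP.
have [hP PP] := pP.
rewrite scaler_eq0 gt_eqF //= => /eqP qPq.
have /adjM_eq0/(congr1 (fun M => M ^t*)) : (P *m q) ^t* *m (P *m q) = 0.
  by rewrite adjmxM hq hP -mulmxA [P *m _]mulmxA PP mulmxA.
by rewrite adjmxM hq hP adjmx0.
Qed.

End Strict.

(** * Commuting absolutely compatible pairs *)

Section AbsolutelyCompatible.

(** The left side is f (s^2, t^2) with
    f (u, v) = 1 + u^2 + v^2 - 2 u - 2 v - 2 u v, and
    f (r^2, (1 - r)^2) = 0; the right side is the expansion of
    f (s^2, t^2) - f (r^2, (1 - r)^2) one variable at a time.  It puts the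
    product in the ideal generated by s^2 - r^2 and t^2 - (1 - r)^2, which
    is the form that can be evaluated at a matrix. *)
Lemma compat_identity (R : comNzRingType) (s t r : R) :
  (1 + s - t) * (1 - s + t) * ((1 - s - t) * (1 + s + t)) =
    (s * s - r * r) * (s * s + r * r - 2 - 2 * (t * t))
  + (t * t - (1 - r) * (1 - r)) * (t * t + (1 - r) * (1 - r) - 2 - 2 * (r * r)).
Proof. by ring. Qed.

Variable C : numClosedFieldType.

Lemma absmx_hermitian_sqr n (X : 'M[C]_n) : X ^t* = X ->
  absmx X *m absmx X = X *m X.
Proof. by have [_ ->] := absmxP X => ->. Qed.

(** Asking for polynomials in a common matrix, rather than for commutation,
    reduces the computation to the commutative identity above. *)
Lemma compat_poly_det n (A B M : 'M[C]_n.+1) (s t r : {poly C}) :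
  A ^t* = A -> B ^t* = B -> absolutely_compatible A B ->
  A - B = horner_mx M s -> 1%:M - A - B = horner_mx M t ->
  absmx (A - B) = horner_mx M r ->
  (\det A * \det (1%:M - A)) * (\det B * \det (1%:M - B)) = 0.
Proof.
move=> hA hB AB Es Et Er.
have hS : (A - B) ^t* = A - B by rewrite adjmxB hA hB.
have hT : (1%:M - A - B) ^t* = 1%:M - A - B by rewrite !adjmxB adjmx1 hA hB.
have Er' : absmx (1%:M - A - B) = horner_mx M (1 - r).
  have M1 : horner_mx M 1 = 1%:M by exact: rmorph1.
  by rewrite rmorphB /= -Er M1 -[1%:M in RHS]AB [RHS]addrC addKr.
have s2 : horner_mx M (s * s - r * r) = 0.
  by rewrite rmorphB !rmorphM /= -Es -Er -!mulmxE absmx_hermitian_sqr // subrr.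
have t2 : horner_mx M (t * t - (1 - r) * (1 - r)) = 0.
  by rewrite rmorphB 2!rmorphM /= -Et -Er' -!mulmxE absmx_hermitian_sqr // subrr.
have := congr1 (horner_mx M) (compat_identity s t r).
rewrite [RHS]rmorphD [X in _ = X + _]rmorphM [X in _ = _ + X]rmorphM /= s2 t2.
rewrite !mul0r addr0.
rewrite !(rmorphM, rmorphD, rmorphN, rmorph1) /= -Es -Et => E.
have : (2 *: A) *m (2 *: (1%:M - A)) *m ((2 *: B) *m (2 *: (1%:M - B))) = 0.
  rewrite -E -!mulmxE; apply: congr2; apply: congr2;
    by apply/matrixP => i j; rewrite !mxE; ring.
move=> /(congr1 determinant)/eqP; rewrite det0 !det_mulmx !detZ.
rewrite !mulf_eq0 expf_eq0 pnatr_eq0 !andbF /= => dets.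
by apply/eqP; rewrite !mulf_eq0.
Qed.

End AbsolutelyCompatible.

(** * Two by two matrices *)

Section TwoByTwo.

(** Cayley-Hamilton in size 2: d is the opposite of the determinant. *)
Lemma sqr_mx2 (R : comNzRingType) (X : 'M[R]_2) :
  exists d, X *m X = \tr X *: X + d%:M.
Proof.
exists (X 0 1 * X 1 0 - X 0 0 * X 1 1).
have ord2 (k : 'I_2) : k = 0 \/ k = 1.
  by case: k => [[|[|//]] ?]; [left|right]; apply/val_inj.
have lift01 : lift ord0 ord0 = 1 :> 'I_2 by apply/val_inj.
apply/matrixP => i j; rewrite !mxE /mxtrace !big_ord_recl !big_ord0 lift01.
by case: (ord2 i) => ->; case: (ord2 j) => ->; rewrite /= ?mulr1n ?mulr0n; ring.
Qed.

(** Comparing the characteristic equations of X and S shows that tr(X) X and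
    tr(S) S differ by a scalar; the two cases are tr(S) = 0 and tr(S) <> 0. *)
Lemma sqr_eq_mx2 (F : fieldType) (X S : 'M[F]_2) : X *m X = S *m S ->
  \tr X != 0 ->
  (exists x, X = x%:M) \/ (exists a c, S = a *: X + c%:M).
Proof.
have [d Xd] := sqr_mx2 X; have [e Se] := sqr_mx2 S.
rewrite Xd Se => E trX.
have [trS0|trS] := eqVneq (\tr S) 0; [left|right].
  exists ((\tr X)^-1 * (e - d)).
  apply: (scalerI trX); rewrite scale_scalar_mx mulVKf //.
  by apply: (addIr d%:M); rewrite E trS0 scale0r add0r -raddfD subrK.
exists ((\tr S)^-1 * \tr X), ((\tr S)^-1 * (d - e)).
apply: (scalerI trS); rewrite scalerDr scalerA scale_scalar_mx !mulVKf //.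
by apply: (addIr e%:M); rewrite -E -addrA -raddfD subrK.
Qed.

(** The characteristic equation reads (1 - tr E) E = - det E, so that E is a
    scalar idempotent, 0 or 1, unless its trace is 1. *)
Lemma idempotent_mx2_trace (F : fieldType) (E : 'M[F]_2) :
  E *m E = E -> E <> 0 -> E <> 1%:M -> \tr E = 1.
Proof.
move=> EE E0 E1; apply/eqP; apply: contra_notT E1 => tr1.
have [d Ed] := sqr_mx2 E.
have nz : 1 - \tr E != 0 by rewrite subr_eq0 eq_sym.
have Esc : E = ((1 - \tr E)^-1 * d)%:M.
  apply: (scalerI nz); rewrite scale_scalar_mx mulVKf // scalerBl scale1r.
  by rewrite -{1}EE Ed [_ + d%:M]addrC addrK.
move: Esc EE E0; set c := _ * d => ->.
rewrite -scalar_mxM => /matrixP/(_ 0 0); rewrite !mxE /= !mulr1n => /eqP.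
rewrite -subr_eq0 -{3}[c]mulr1 -mulrBr mulf_eq0 subr_eq0.
by case/orP => /eqP -> //; rewrite -scalemx1 scale0r.
Qed.

Lemma idempotent_mx2_rank1 (F : fieldType) (E : 'M[F]_2) : E *m E = E ->
  \rank E = 1%N <-> E <> 0 /\ E <> 1%:M.
Proof.
move=> EE; split=> [rE|[E0 E1]].
  by split=> E1; move: rE; rewrite E1 ?mxrank0 ?mxrank1.
have : (0 < \rank E)%N by rewrite lt0n mxrank_eq0; apply/eqP.
have : (\rank E <= 2)%N by apply: rank_leq_row.
case rE : (\rank E) => [|[|[|]]] // _ _; case: E1.
have Eu : E \in unitmx by rewrite -row_free_unit /row_free rE.
by rewrite -[E](mulKmx Eu) EE mulVmx.
Qed.

Variable C : numClosedFieldType.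
Implicit Types A B P Q : 'M[C]_2.

(** The matrix 1 - P - Q is idempotent with trace 2 - 1 - 1 = 0. *)
Lemma orthogonal_projections_mx2 P Q : projection P -> projection Q ->
  P <> 0 -> Q <> 0 -> P *m Q = 0 -> Q = 1%:M - P.
Proof.
move=> [hP PP] [hQ QQ] P0 Q0 PQ.
have P1 : P <> 1%:M by move=> P1; apply: Q0; rewrite -[Q]mul1mx -P1.
have Q1 : Q <> 1%:M by move=> Q1; apply: P0; rewrite -[P]mulmx1 -Q1.
have QP : Q *m P = 0 by rewrite -[Q *m P]trmxCK adjmxM hP hQ PQ adjmx0.
have RR : (1%:M - P - Q) *m (1%:M - P - Q) = 1%:M - P - Q.
  rewrite !mulmxBl mul1mx !mulmxBr !mulmx1 PP QQ PQ QP.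
  by rewrite !subrr !subr0 subrr subr0.
have trR : \tr (1%:M - P - Q) = 0.
  rewrite !linearB /= mxtrace1 !idempotent_mx2_trace //.
  by rewrite -addrA -opprD subrr.
apply/eqP; rewrite eq_sym -subr_eq0; apply/eqP.
apply: contrapT => R0; have R1 : 1%:M - P - Q <> 1%:M.
  by move=> R1; move: trR; rewrite R1 mxtrace1 => /eqP; rewrite pnatr_eq0.
by have /eqP := idempotent_mx2_trace RR R0 R1; rewrite trR eq_sym oner_eq0.
Qed.

(** A projection q killing P and Q would make both equal to 1 - q. If q lies
    below the mix X, then q (X - q) q and q (1 - X) q are positive with sum 0,
    so that q kills 1 - P and 1 - Q. *)
Lemma strict_projection_mix P Q (a b : C) :
  projection P -> projection Q -> P <> 0 -> P <> 1%:M -> Q <> 0 -> Q <> 1%:M ->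
  P <> Q -> 0 < a -> 0 < b -> a + b = 1 -> strict (a *: P + b *: Q).
Proof.
move=> pP pQ P0 P1 Q0 Q1 PQ a0 b0 ab; apply/strictP => //.
have kill (E F q : 'M[C]_2) : projection q -> projection E -> projection F ->
    E <> 0 -> F <> 0 -> E <> F -> q *m (a *: E + b *: F) *m q = 0 -> q = 0.
  move=> pq pE pF E0 F0 EF /(projection_pos_comb_eq0 a0 b0 pq pE pF) [qE qF].
  apply: contrapT => q0; apply: EF.
  rewrite (orthogonal_projections_mx2 pq pE) //.
  by rewrite (orthogonal_projections_mx2 pq pF).
split=> q pq; last first.
  by move=> qX; apply: (kill P Q) => //; rewrite qX mul0mx.
move=> qX; have pP' := projectionC pP; have pQ' := projectionC pQ.
apply: (kill (1%:M - P) (1%:M - Q)) => //.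
- by move/eqP; rewrite subr_eq0 => /eqP/esym.
- by move/eqP; rewrite subr_eq0 => /eqP/esym.
- by move/addrI/oppr_inj.
have [hq qq] := pq.
have Ec : a *: (1%:M - P) + b *: (1%:M - Q) = 1%:M - (a *: P + b *: Q).
  by rewrite !scalerBr addrACA -scalerDl ab scale1r opprD.
rewrite Ec.
have p1 : posmx (q *m (1%:M - (a *: P + b *: Q)) *m q).
  rewrite -Ec -{1}hq; apply: posmx_conj; apply: posmxD;
  by apply: posmxZ; [exact: ltW|exact: projection_posmx].
have p2 : posmx (q *m (a *: P + b *: Q - q) *m q).
  by rewrite -{1}hq; apply: posmx_conj.
apply: posmx_addr_eq0 p1 p2 _.
rewrite -mulmxDl -mulmxDr addrA subrK mulmxBr mulmxBl mulmx1 !qq.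
by rewrite subrr.
Qed.

Lemma projection_reflection n (P : 'M[C]_n) : projection P ->
  (1%:M - 2 *: P) ^t* = 1%:M - 2 *: P /\
  (1%:M - 2 *: P) *m (1%:M - 2 *: P) = 1%:M.
Proof.
move=> [hP PP]; split; first by rewrite adjmxB adjmx1 adjmxZ_real ?realn // hP.
rewrite mulmxBl mul1mx -scalemxAl mulmxBr mulmx1 -scalemxAr PP.
by apply/matrixP => i j; rewrite !mxE; ring.
Qed.

Lemma half_eq n (M N : 'M[C]_n) : 2^-1 *: (1%:M + M) = N -> M = 2 *: N - 1%:M.
Proof.
by move=> <-; rewrite scalerA mulfV ?pnatr_eq0 // scale1r [_ + M]addrC addrK.
Qed.

Lemma half_projection n (J : 'M[C]_n) : J ^t* = J -> J *m J = 1%:M ->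
  projection (2^-1 *: (1%:M + J)).
Proof.
move=> hJ JJ; split.
  by rewrite adjmxZ_real ?adjmxD ?adjmx1 ?hJ // realV realn.
rewrite -scalemxAl -scalemxAr mulmxDr !mulmxDl !mulmx1 mul1mx JJ.
by apply/matrixP => i j; rewrite !mxE; field.
Qed.

Lemma absmx_scalar_reflection n (Z : 'M[C]_n.+1) z :
  Z ^t* = Z -> absmx Z = z%:M -> Z <> 0 ->
  0 < z /\ exists J, [/\ Z = z *: J, J ^t* = J & J *m J = 1%:M].
Proof.
move=> hZ Zz Z0; have [pz zz] := absmxP Z.
rewrite hZ Zz -scalar_mxM in zz; rewrite Zz in pz.
have z_ge0 : 0 <= z by have := posmx_diag_ge0 0 pz; rewrite mxE.
have z_neq0 : z != 0.
  apply: contra_notN Z0 => /eqP z0; apply: adjM_eq0.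
  by rewrite hZ -zz z0 mul0r -scalemx1 scale0r.
split; first by rewrite lt_def z_neq0.
exists (z^-1 *: Z); split; first by rewrite scalerA mulfV // scale1r.
  by rewrite adjmxZ_real ?realV ?ger0_real // hZ.
by rewrite -scalemxAl -scalemxAr -zz !scale_scalar_mx mulKf // mulVf.
Qed.

Lemma affine_horner_mx n (M : 'M[C]_n.+1) u v :
  u *: M + v%:M = horner_mx M (u%:P * 'X + v%:P).
Proof.
by rewrite rmorphD rmorphM /= !horner_mx_C horner_mx_X -mulmxE mul_scalar_mx.
Qed.

(** The forward implication over any numeric closed field.  The number x is the
    scalar |A - B|, and P and Q are (1 - K) / 2 and (1 + J) / 2 for the
    reflections J = (A - B) / x and K = (1 - A - B) / (1 - x). *)
Lemma strict_compat_decomposition A B : lemx 0 A -> lemx 0 B ->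
  strict A -> strict B -> absolutely_compatible A B ->
  exists P Q (x : C),
    [/\ projection P /\ (P <> 0 /\ P <> 1%:M),
        projection Q /\ (Q <> 0 /\ Q <> 1%:M),
        P <> Q /\ P <> 1%:M - Q,
        0 < x < 1
      & A = (1 - x) *: P + x *: Q /\ B = (1 - x) *: P + x *: (1%:M - Q)].
Proof.
move=> pA pB sA sB AB.
have [dA dA'] := strict_det (ltn0Sn 1) pA sA.
have [dB dB'] := strict_det (ltn0Sn 1) pB sB.
move: (pA) (pB); rewrite /lemx !subr0 => -[hA _] [hB _].
pose S : 'M[C]_2 := A - B; pose T : 'M[C]_2 := 1%:M - A - B; pose X := absmx S.
have hS : S ^t* = S by rewrite adjmxB hA hB.
have hT : T ^t* = T by rewrite !adjmxB adjmx1 hA hB.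
have XT : absmx T = 1%:M - X.
  by rewrite -[1%:M]AB [_ + absmx _]addrC addrK.
(* Affine functions of M are polynomials in M, so strictness applies. *)
have nonaffine M a c a' c' a'' c'' : S = a *: M + c%:M -> T = a' *: M + c'%:M ->
    X <> a'' *: M + c''%:M.
  rewrite !affine_horner_mx => ES ET EX.
  have /eqP := compat_poly_det hA hB AB ES ET EX.
  by rewrite !mulf_eq0 (negPf dA) (negPf dA') (negPf dB) (negPf dB').
(* If S is affine in X and T is affine in 1 - X, both are affine in X. *)
have [x Xx] : exists x, X = x%:M.
  have [[hX pX] XX] := absmxP S; have [pY YY] := absmxP T.
  rewrite hS -/X in XX; rewrite hT XT in YY; rewrite XT in pY.
  have [trX|trX] := eqVneq (\tr X) 0.
    exists 0; rewrite -scalemx1 scale0r; exact: posmx_trace_eq0 (conj hX pX) trX.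
  have [trY|trY] := eqVneq (\tr (1%:M - X)) 0.
    exists 1; apply/eqP; rewrite eq_sym -subr_eq0; apply/eqP.
    exact: posmx_trace_eq0 pY trY.
  have [//|[a [c Sa]]] := sqr_eq_mx2 XX trX.
  have [[y Yy]|[a' [c' Ta]]] := sqr_eq_mx2 YY trY.
    by exists (1 - y); rewrite raddfB /= -Yy subKr.
  case: (nonaffine X a c (- a') (a' + c') 1 0) => //.
    rewrite Ta [(a' + c')%:M]raddfD /= -[a'%:M]scalemx1 scalerBr scaleNr addrA.
    by rewrite [- _ + _]addrC.
  by rewrite scale1r -scalemx1 scale0r addr0.
pose y := 1 - x.
have Yy : absmx T = y%:M by rewrite XT Xx raddfB.
have nonaff M a c a' c' : S = a *: M + c%:M -> T = a' *: M + c'%:M -> False.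
  move=> ES ET; apply: (nonaffine M a c a' c' 0 x ES ET).
  by rewrite scale0r add0r.
have zero_aff (M : 'M[C]_2) : 0 = 0 *: M + 0%:M by rewrite raddf0 scale0r addr0.
have id_aff (M : 'M[C]_2) : M = 1 *: M + 0%:M by rewrite raddf0 scale1r addr0.
have S0 : S <> 0 by move=> S0; apply: (nonaff T 0 0 1 0) => //; rewrite S0.
have T0 : T <> 0 by move=> T0; apply: (nonaff S 1 0 0 0) => //; rewrite T0.
have [x_gt0 [J [SJ hJ JJ]]] := absmx_scalar_reflection hS Xx S0.
have [y_gt0 [K [TK hK KK]]] := absmx_scalar_reflection hT Yy T0.
have hNK : (- K) ^t* = - K by rewrite -sub0r adjmxB adjmx0 hK.
have NKNK : (- K) *m (- K) = 1%:M by rewrite mulmxN mulNmx opprK.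
(* Each excluded coincidence between J, K and the scalars would make S and T
   affine functions of a single matrix. *)
have J_scalar c : J <> c%:M.
  move=> Jc; apply: (nonaff T 0 (x * c) 1 0) => //.
  by rewrite SJ Jc scale0r add0r scale_scalar_mx.
have K_scalar c : K <> c%:M.
  move=> Kc; apply: (nonaff S 1 0 0 (y * c)) => //.
  by rewrite TK Kc scale0r add0r scale_scalar_mx.
have JK c : K <> c *: J.
  move=> KJ; apply: (nonaff J x 0 (y * c) 0).
    by rewrite raddf0 addr0.
  by rewrite raddf0 addr0 -scalerA -KJ.
exists (2^-1 *: (1%:M - K)), (2^-1 *: (1%:M + J)), x; split.
- split; first exact: half_projection.
  split=> /half_eq /(canRL (@opprK _)).
    by rewrite scaler0 sub0r opprK; apply: K_scalar.
  by rewrite mulr2n scalerDl scale1r addrK -raddfN; apply: K_scalar.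
- split; first exact: half_projection.
  split=> /half_eq.
    by rewrite scaler0 sub0r -raddfN; apply: J_scalar.
  by rewrite mulr2n scalerDl scale1r addrK; apply: J_scalar.
- have Jhalf := half_eq (erefl (2^-1 *: (1%:M + J))).
  split=> /half_eq /(canRL (@opprK _)).
    by rewrite -Jhalf -scaleN1r; apply: JK.
  have -> : - (2 *: (1%:M - 2^-1 *: (1%:M + J)) - 1%:M) = 1 *: J.
    by apply/matrixP => i j; rewrite !mxE; field.
  exact: JK.
- by rewrite x_gt0 -subr_gt0.
- have EA : A = 2^-1 *: (1%:M + S - T) by apply/matrixP => i j; rewrite !mxE; field.
  have EB : B = 2^-1 *: (1%:M - S - T) by apply/matrixP => i j; rewrite !mxE; field.
  rewrite EA EB SJ TK /y.
  by split; apply/matrixP => i j; rewrite !mxE; field.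
Qed.

End TwoByTwo.

(** * The characterization *)

Theorem theorem4p1 (R : realType) (A B : 'M[R[i]]_2)
    (A_ge0 : lemx 0 A) (A_le1 : lemx A 1%:M)
    (B_ge0 : lemx 0 B) (B_le1 : lemx B 1%:M) :
  (strict A /\ strict B /\ absolutely_compatible A B) <->
  (exists (P Q : 'M[R[i]]_2) (lambda : R),
     [/\ projection P /\ \rank P = 1%N,
         projection Q /\ \rank Q = 1%N,
         P <> Q /\ P <> 1%:M - Q,
         0 < lambda < 1
       & A = (1 - lambda)%:C *: P + lambda%:C *: Q /\
         B = (1 - lambda)%:C *: P + lambda%:C *: (1%:M - Q)]).
Proof.
split=> [[sA [sB AB]]|].
  have [P [Q [x [[pP ntP] [pQ ntQ] PQ /andP[x0 x1] [EA EB]]]]] :=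
    strict_compat_decomposition A_ge0 B_ge0 sA sB AB.
  have xE : (complex.Re x)%:C = x by apply: RRe_real; apply: gtr0_real.
  exists P, Q, (complex.Re x); split=> //.
  - by split=> //; apply/idempotent_mx2_rank1 => //; case: pP.
  - by split=> //; apply/idempotent_mx2_rank1 => //; case: pQ.
  - by rewrite -!ltcR xE x0.
  - by rewrite rmorphB rmorph1 /= xE.
move=> [P [Q [l [[pP rP] [pQ rQ] [PQ PQ'] /andP[l0 l1] [EA EB]]]]].
have [hP PP] := pP; have [hQ QQ] := pQ.
have [P0 P1] := (idempotent_mx2_rank1 PP).1 rP.
have [Q0 Q1] := (idempotent_mx2_rank1 QQ).1 rQ.
have lC0 : 0 < l%:C by rewrite ltcR.
have mC0 : 0 < (1 - l)%:C by rewrite ltcR subr_gt0.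
have sum1 : (1 - l)%:C + l%:C = 1 by rewrite -rmorphD subrK.
split; [|split].
- by rewrite EA; apply: strict_projection_mix.
- rewrite EB; apply: strict_projection_mix => //; first exact: projectionC.
    by move/eqP; rewrite subr_eq0 => /eqP/esym.
  by move/(congr1 (fun M => 1%:M - M)); rewrite subKr subrr.
have ES : A - B = l%:C *: (1%:M - 2 *: (1%:M - Q)).
  by rewrite EA EB; apply/matrixP => i j; rewrite !mxE; ring.
have ET : 1%:M - A - B = (1 - l)%:C *: (1%:M - 2 *: P).
  by rewrite -sum1 EA EB; apply/matrixP => i j; rewrite !mxE; ring.
have [hJP JJP] := projection_reflection pP.
have [hJQ JJQ] := projection_reflection (projectionC pQ).
rewrite /absolutely_compatible ES ET !absmx_scaled_reflection //.
by rewrite -raddfD addrC sum1.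
Qed.
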